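(* Let $\mathfrak{B}$ be a bornology with a closed base on a topological space $X$, and let $X$ be a $\mathfrak{B}$-Lindelöf space. The following hold. (1) $X$ satisfies $S_{fin}(\Gamma_{\mathfrak{B}},\mathcal{O})$ if and only if $X$ satisfies $U_{fin}(\mathcal{O}_{\mathfrak{B}},\mathcal{O})$. (2) $X$ satisfies $U_{fin}(\Gamma_{\mathfrak{B}},\mathcal{O})$ if and only if $X$ satisfies $U_{fin}(\mathcal{O}_{\mathfrak{B}},\mathcal{O})$. (3) $X$ satisfies $S_{fin}(\mathcal{O}_{\mathfrak{B}},\mathcal{O})$ if and only if $X$ satisfies $U_{fin}(\mathcal{O}_{\mathfrak{B}},\mathcal{O})$.
   Context: A bornology $\mathfrak{B}$ on $X$ is a family of subsets of $X$ that is closed under taking subsets and finite unions and covers $X$; by standing convention $X\notin\mathfrak{B}$. A base of $\mathfrak{B}$ is a subfamily $\mathfrak{B}_0\subseteq\mathfrak{B}$ such that every $B\in\mathfrak{B}$ is contained in some $B_0\in\mathfrak{B}_0$; it is closed if its members are closed subsets of $X$. $\mathcal{O}$ is the collection of all open covers of $X$. $\mathcal{O}_{\mathfrak{B}}$ is the collection of all open $\mathfrak{B}$-covers of $X$: families $\mathcal{U}$ of open subsets of $X$ with $X\notin\mathcal{U}$ such that every $B\in\mathfrak{B}$ is contained in some $U\in\mathcal{U}$. $X$ is $\mathfrak{B}$-Lindelöf if every open $\mathfrak{B}$-cover of $X$ contains a countable subfamily that is a $\mathfrak{B}$-cover of $X$. $\Gamma_{\mathfrak{B}}$ is the collection of all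 $\gamma_{\mathfrak{B}}$-covers of $X$: infinite covers $\mathcal{U}=\{U_n:n\in\omega\}$ of $X$ by proper open subsets such that for each $B\in\mathfrak{B}$ there is $n_0\in\omega$ with $B\subseteq U_n$ for all $n\ge n_0$. For collections $\mathcal{A},\mathcal{B}$ of families of subsets of $X$: $S_{fin}(\mathcal{A},\mathcal{B})$ means that for each sequence $\{\mathcal{U}_n:n\in\omega\}$ of elements of $\mathcal{A}$ there are finite (possibly empty) $\mathcal{V}_n\subseteq\mathcal{U}_n$ with $\bigcup_{n\in\omega}\mathcal{V}_n\in\mathcal{B}$. $U_{fin}(\mathcal{A},\mathcal{B})$ means that for each such sequence there are finite (possibly empty) $\mathcal{V}_n\subseteq\mathcal{U}_n$ such that $\{\bigcup\mathcal{V}_n:n\in\omega\}\in\mathcal{B}$ or $\bigcup\mathcal{V}_n=X$ for some $n$. *)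

(* Defs.v *)
From mathcomp Require Import all_boot all_order.
From mathcomp Require Import all_classical.
From mathcomp Require Import topology.

Set Implicit Arguments.
Unset Strict Implicit.
Unset Printing Implicit Defensive.

Local Open Scope classical_set_scope.

(* The finite unions in [bornology_bigcup] include the empty one, so the empty
   set always belongs to a bornology. *)
Record bornology (X : Type) (BB : set (set X)) : Prop := {
  bornology_sub : forall A B : set X, BB B -> A `<=` B -> BB A ;
  bornology_bigcup : forall F : set (set X),
    finite_set F -> F `<=` BB -> BB (\bigcup_(A in F) A) ;
  bornology_cover : \bigcup_(B in BB) B = setT ;
  bornology_proper : ~ BB setT }.

Definition bornology_base (X : Type) (BB BB0 : set (set X)) : Prop :=
  BB0 `<=` BB /\ forall B, BB B -> exists2 B0, BB0 B0 & B `<=` B0.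

Definition has_closed_base (X : topologicalType) (BB : set (set X)) : Prop :=
  exists BB0 : set (set X),
    bornology_base BB BB0 /\ forall B0, BB0 B0 -> closed B0.

Definition open_covers (X : topologicalType) : set (set (set X)) :=
  [set U | (forall A, U A -> open A) /\ \bigcup_(A in U) A = setT].

Definition open_B_covers (X : topologicalType) (BB : set (set X)) :
    set (set (set X)) :=
  [set U | [/\ forall A, U A -> open A, ~ U setT &
               forall B, BB B -> exists2 A, U A & B `<=` A]].

Definition B_Lindelof (X : topologicalType) (BB : set (set X)) : Prop :=
  forall U, open_B_covers BB U ->
    exists V : set (set X), [/\ V `<=` U, countable V & open_B_covers BB V].

Definition gamma_B_covers (X : topologicalType) (BB : set (set X)) :
    set (set (set X)) :=
  [set U | [/\ infinite_set U,
               \bigcup_(A in U) A = setT,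
               forall A, U A -> open A /\ A <> setT &
               exists u : nat -> set X, range u = U /\
                 forall B, BB B ->
                   exists n0, forall n, (n0 <= n)%N -> B `<=` u n]].

Definition S_fin (X : Type) (AA CC : set (set (set X))) : Prop :=
  forall U : nat -> set (set X), (forall n, AA (U n)) ->
    exists V : nat -> set (set X),
      (forall n, finite_set (V n) /\ V n `<=` U n) /\ CC (\bigcup_n V n).

Definition U_fin (X : Type) (AA CC : set (set (set X))) : Prop :=
  forall U : nat -> set (set X), (forall n, AA (U n)) ->
    exists V : nat -> set (set X),
      (forall n, finite_set (V n) /\ V n `<=` U n) /\
      (CC (range (fun n => \bigcup_(A in V n) A)) \/
       exists n, \bigcup_(A in V n) A = setT).

(* Main.v *)
Require Import Defs.
From mathcomp Require Import all_boot all_order.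
From mathcomp Require Import all_classical.
From mathcomp Require Import topology.

(** When the target is the collection of all open covers, [S_fin] and [U_fin]
    ask for the same thing: finite selections whose members together cover the
    space ([S_fin_open_coversE]). All three equivalences therefore reduce to the
    equivalence of [S_fin] for gamma_B-covers and for open B-covers.

    One direction holds because every gamma_B-cover is an open B-cover. For the
    other, the Lindelof hypothesis replaces the [n]-th open B-cover by a
    subcover enumerated as [u n 0, u n 1, ...], whose partial unions increase
    and so eventually contain each bounded set. If one of these partial unions
    is already the whole space, it is a finite selection and nothing remains to
    be done. Otherwise the partial unions form a gamma_B-cover
    ([partial_union_gamma]). By monotonicity, finitely many of them lie in a
    single one, that is, in the union of finitely many [u n j]
    ([finite_sub_partial_union]), so a finite selection of partial unions yields
    one of members of the original cover. *)

Set Implicit Arguments.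
Unset Strict Implicit.
Unset Printing Implicit Defensive.

Local Open Scope classical_set_scope.

(** Openness of the members makes openness of the selected family, or of its
    finite unions, automatic, so both principles only require every point to lie
    in some selected set. The alternative in [U_fin] that a single finite union
    is the whole space is a special case of this. *)
Lemma S_fin_open_coversE (X : topologicalType) (AA : set (set (set X))) :
    (forall U, AA U -> forall A, U A -> open A) ->
  S_fin AA (@open_covers X) <-> U_fin AA (@open_covers X).
Proof.
move=> AAopen; split=> AAfin U UA; have [V [Vfin HV]] := AAfin U UA;
  have Vopen n A : V n A -> open A
    by move=> VA; apply: (AAopen _ (UA n)); exact: (Vfin n).2.
- exists V; split=> //; left; split.
  + by move=> _ [n _ <-]; apply: bigcup_open => A; exact: Vopen.
  + apply/seteqP; split=> // x _.
    have [A [n _ VA] Ax] : (\bigcup_(A in \bigcup_n V n) A) x by rewrite HV.2.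
    by exists (\bigcup_(B in V n) B); [exists n | exists A].
- exists V; split=> //; split; first by move=> A [n _]; exact: Vopen.
  apply/seteqP; split=> // x _.
  have [n [A VA Ax]] : exists n, (\bigcup_(A in V n) A) x.
    case: HV => [[_ cov]|[n cov]]; last by exists n; rewrite cov.
    have [_ [n _ <-] Ax] : (\bigcup_(A in range
        (fun n => \bigcup_(A in V n) A)) A) x by rewrite cov.
    by exists n.
  by exists A => //; exists n.
Qed.

Lemma S_fin_subl (X : Type) (AA AA' CC : set (set (set X))) :
  AA' `<=` AA -> S_fin AA CC -> S_fin AA' CC.
Proof. by move=> sub fin U UA; apply: fin => n; exact/sub/UA. Qed.

Lemma gamma_sub_open_B_covers (X : topologicalType) (BB : set (set X)) :
  gamma_B_covers BB `<=` open_B_covers BB.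
Proof.
move=> U [_ _ Uop [u [uU uB]]]; split.
- by move=> A /Uop[].
- by move=> /Uop[].
- move=> B /uB[n0 Bn0]; exists (u n0); [by rewrite -uU; exists n0 | exact: Bn0].
Qed.

Lemma open_B_covers_bigcup (X : topologicalType) (BB : set (set X)) U :
  bornology BB -> open_B_covers BB U -> \bigcup_(A in U) A = setT.
Proof.
move=> hBB [_ _ UB]; apply/seteqP; split=> // x _.
have [B /UB[A UA BA] Bx] : (\bigcup_(B in BB) B) x.
  by rewrite (bornology_cover hBB).
by exists A => //; exact: BA.
Qed.

(** A countable subcover can be enumerated by [nat] because it is nonempty: some
    member must contain the bounded set [set0]. *)
Lemma B_Lindelof_range (X : topologicalType) (BB : set (set X)) U :
    bornology BB -> B_Lindelof BB -> open_B_covers BB U ->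
  exists u : nat -> set X, range u `<=` U /\ open_B_covers BB (range u).
Proof.
move=> hBB hL /hL[V [VU Vc VB]].
case: (pfcard_geP Vc) => [V0|[u]].
  have BB0 : BB set0.
    by rewrite -(bigcup_set0 (@id (set X))); apply: (bornology_bigcup hBB).
  by case: VB => _ _ /(_ _ BB0)[A]; rewrite V0.
have uV : range u = V by apply: surj_image_eq.
by exists u; rewrite uV.
Qed.

Definition partial_union (X : Type) (u : nat -> set X) (k : nat) : set X :=
  \bigcup_(j in `I_k.+1) u j.

Lemma partial_union_mono (X : Type) (u : nat -> set X) m n :
  (m <= n)%N -> partial_union u m `<=` partial_union u n.
Proof.
by move=> mn x [j /= jm ujx]; exists j => //=; exact: leq_trans jm _.
Qed.

(** Used twice: it shows that the partial unions of a cover are infinite in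
    number when none is the whole space, and it turns a finite selection of
    partial unions into a finite selection of terms of the sequence. *)
Lemma finite_sub_partial_union (X : Type) (u : nat -> set X)
    (F : set (set X)) : finite_set F -> F `<=` range (partial_union u) ->
  exists k, \bigcup_(A in F) A `<=` partial_union u k.
Proof.
move=> /finite_seqP[s ->]; elim: s => [|A s IHs] sR.
  by exists 0 => x [].
have [k sk] : exists k, \bigcup_(A in [set` s]) A `<=` partial_union u k.
  by apply: IHs => B /= Bs; apply: sR; rewrite /= inE Bs orbT.
have [m _ mA] : range (partial_union u) A by apply: sR; rewrite /= inE eqxx.
exists (maxn k m) => x [B /=]; rewrite inE => /orP[/eqP-> |Bs Bx].
  by rewrite -mA; apply: partial_union_mono; rewrite leq_maxr.
by apply: (partial_union_mono (leq_maxl k m)); apply: sk; exists B.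
Qed.

(** Partial unions increase, so once one term contains a bounded set, all later
    partial unions do. Were there only finitely many of them, one would contain
    all the others and hence be the whole space. *)
Lemma partial_union_gamma (X : topologicalType) (BB : set (set X))
    (u : nat -> set X) : bornology BB -> open_B_covers BB (range u) ->
    (forall k, partial_union u k <> setT) ->
  gamma_B_covers BB (range (partial_union u)).
Proof.
move=> hBB uB proper; have [uop _ uBB] := uB.
have cover : \bigcup_(A in range (partial_union u)) A = setT.
  apply/seteqP; split=> // x _.
  have [_ [n _ <-] ux] : (\bigcup_(A in range u) A) x.
    by rewrite (open_B_covers_bigcup hBB uB).
  by exists (partial_union u n); [exists n | exists n => /=].
split=> //.
- move=> fin; have [k] := finite_sub_partial_union fin (@subset_refl _ _).
  by rewrite cover => kT; apply: (proper k); apply/seteqP; split.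
- move=> _ [k _ <-]; split; last exact: proper.
  by apply: bigcup_open => j _; apply: uop; exists j.
- exists (partial_union u); split=> // B /uBB[_ [n0 _ <-] Bn0].
  by exists n0 => n n0n x /Bn0 ux; exists n0.
Qed.

(** The Lindelof property lets each open B-cover be read as a sequence, and its
    partial unions turn that sequence into a gamma_B-cover. *)
Lemma S_fin_gamma_to_B (X : topologicalType) (BB : set (set X)) :
    bornology BB -> B_Lindelof BB ->
  S_fin (gamma_B_covers BB) (@open_covers X) ->
  S_fin (open_B_covers BB) (@open_covers X).
Proof.
move=> hBB hL gfin U UB.
have /choice[u uP] n := B_Lindelof_range hBB hL (UB n).
(* [k n] is where the [n]-th enumeration is cut: the selection consists of
   the terms [u n 0, ..., u n (k n)]. *)
suff [k kcov] : exists k : nat -> nat, forall x,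
    exists n, partial_union (u n) (k n) x.
  exists (fun n => u n @` `I_(k n).+1); split=> [n|].
    split; first exact/finite_image/finite_II.
    by move=> _ [j _ <-]; apply: (uP n).1; exists j.
  split.
    move=> _ [n _ [j _ <-]]; case: (UB n) => Uop _ _; apply: Uop.
    by apply: (uP n).1; exists j.
  apply/seteqP; split=> // x _; have [n [j jk ux]] := kcov x.
  by exists (u n j) => //; exists n => //; exists j.
have [[n [k nk]]|noT] := pselect (exists n k, partial_union (u n) k = setT).
  (* The stage [k] matters only for the cover [n], so a constant cut works. *)
  by exists (fun=> k) => x; exists n; rewrite nk.
have [n|V [Vfin [_ Vcov]]] := gfin (fun n => range (partial_union (u n))).
  apply: partial_union_gamma => //; first exact: (uP n).2.
  by move=> k nk; apply: noT; exists n, k.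
have /choice[k kP] n := finite_sub_partial_union (Vfin n).1 (Vfin n).2.
exists k => x.
have [A [n _ VA] Ax] : (\bigcup_(A in \bigcup_n V n) A) x by rewrite Vcov.
by exists n; apply: kP; exists A.
Qed.

Theorem theorem3p11 (X : topologicalType) (BB : set (set X))
    (hBB : bornology BB) (hbase : has_closed_base BB)
    (hLind : B_Lindelof BB) :
  [/\ S_fin (gamma_B_covers BB) (@open_covers X) <->
        U_fin (open_B_covers BB) (@open_covers X),
      U_fin (gamma_B_covers BB) (@open_covers X) <->
        U_fin (open_B_covers BB) (@open_covers X) &
      S_fin (open_B_covers BB) (@open_covers X) <->
        U_fin (open_B_covers BB) (@open_covers X)].
Proof.
have Bop U : open_B_covers BB U -> forall A, U A -> open A by case.
have Gop U : gamma_B_covers BB U -> forall A, U A -> open A.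
  by move=> /gamma_sub_open_B_covers/Bop.
have SUB := S_fin_open_coversE Bop; have SUG := S_fin_open_coversE Gop.
have SGB : S_fin (gamma_B_covers BB) (@open_covers X) <->
    S_fin (open_B_covers BB) (@open_covers X).
  split; first exact: S_fin_gamma_to_B.
  exact/S_fin_subl/gamma_sub_open_B_covers.
by split; rewrite -?SUB -?SUG.
Qed.
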